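(* Let $k$ be a positive integer and $B$ a non-empty subset of $\mathcal{N}$. Then $B\in\mathbf{\Sigma}^1_k(\mathcal{N})$ if and only if there is a continuous function $f:\mathbb{N}\langle k\rangle\to\mathcal{N}$ with $\mathrm{rng}(f)=B$.
   Context: $\mathcal{N}=\omega^\omega$ is the Baire space. $\mathrm{QCB}_0$ is the cartesian closed category of $T_0$ topological quotients of countably based spaces; the exponential $Y^X$ is the set of continuous maps $X\to Y$ with the sequentialization of the compact-open topology. The Kleene–Kreisel spaces are $\mathbb{N}\langle0\rangle=\omega$ (discrete) and $\mathbb{N}\langle k+1\rangle=\omega^{\mathbb{N}\langle k\rangle}$ (so $\mathbb{N}\langle1\rangle=\mathcal{N}$). For a space $X$: $\mathbf{\Pi}^0_2(X)$ is the family of complements of countable unions of sets $U\setminus V$ with $U,V$ open; $\mathbf{\Sigma}^1_1(X)=\{pr_X(A)\mid A\in\mathbf{\Pi}^0_2(\mathcal{N}\times X)\}$, $\mathbf{\Sigma}^1_{n+1}(X)=\{pr_X(A)\mid A\in\mathbf{\Pi}^1_n(\mathcal{N}\times X)\}$, where $pr_X(A)=\{x\mid\exists p\in\mathcal{N}\,(p,x)\in A\}$ and $\mathbf{\Pi}^1_n(X)$ consists of complements of $\mathbf{\Sigma}^1_n(X)$-sets. (On $\mathcal{N}$ these coincide with the classical projective classes.) *)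

(* Defs.v *)
From HB Require Import structures.
From mathcomp Require Import all_boot all_order all_algebra all_classical.
From mathcomp Require Import reals topology.

Set Implicit Arguments.
Unset Strict Implicit.
Unset Printing Implicit Defensive.

Local Open Scope classical_set_scope.

(* Alias of X carrying the topology of the sequentially open sets of X. *)
Definition sequentialization (X : Type) : Type := X.

Definition seq_open (X : topologicalType) : set_system X :=
  [set A | forall (u : nat -> X) (x : X),
     A x -> u n @[n --> \oo] --> x -> \forall n \near \oo, A (u n)].

Section Sequentialization.
Variable X : topologicalType.

Lemma seq_openT : seq_open [set: X].
Proof. by move=> u x _ _; exact: nearW. Qed.

Lemma seq_openI : setI_closed (@seq_open X).
Proof.
move=> A B oA oB u x [Ax Bx] ux.
by apply: filterI; [exact: oA Ax ux | exact: oB Bx ux].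
Qed.

Lemma seq_open_bigU (I : Type) (F : I -> set X) :
  (forall i, seq_open (F i)) -> seq_open (\bigcup_i F i).
Proof.
move=> oF u x [i _ Fix] ux.
by apply: filterS (oF i u x Fix ux) => n Fin; exists i.
Qed.

HB.instance Definition _ := Choice.on (sequentialization X).
HB.instance Definition _ := isOpenTopological.Build (sequentialization X)
  seq_openT seq_openI seq_open_bigU.

End Sequentialization.

(* The exponential Y^X of QCB_0. The compact-open topology of the library lives
   on all functions X -> Y; it is first restricted to the continuous ones. *)
Definition qcb_exp (X Y : topologicalType) : topologicalType :=
  sequentialization (initial_topology
    (fun f : continuousType X Y => (f : {compact-open, X -> Y}))).

(* The space N<k>. *)
Fixpoint kleene_kreisel (k : nat) : topologicalType :=
  if k is k'.+1 then qcb_exp (kleene_kreisel k') nat else nat.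

(* N, with the product topology. Its points are those of N<1> = qcb_exp nat nat,
   stripped of their (trivial) continuity proofs. *)
Definition Baire : topologicalType := {ptws nat -> nat}.

Definition Pi02 (X : topologicalType) : set_system X :=
  [set A | exists U V : nat -> set X,
     [/\ forall i, open (U i), forall i, open (V i)
       & A = ~` \bigcup_i (U i `\` V i)]].

Arguments Pi02 : clear implicits.

Definition pr (X : Type) (A : set (Baire * X)) : set X :=
  [set x | exists p : Baire, A (p, x)].

Definition complements (X : Type) (F : set_system X) : set_system X :=
  [set ~` A | A in F].

(* Only the levels n >= 1 are meaningful; level 0 is a dummy value that no other
   level uses. Baire * X is the Tychonoff product: it agrees with the product of
   QCB_0 when X is a finite power of Baire, but not for every X. *)
Fixpoint Sigma1 (n : nat) (X : topologicalType) : set_system X :=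
  match n with
  | 0 => set0
  | 1 => [set pr A | A in Pi02 (Baire * X)%type]
  | m.+1 => [set pr A | A in complements (@Sigma1 m (Baire * X)%type)]
  end.

Arguments Sigma1 : clear implicits.

Definition Pi1 (n : nat) (X : topologicalType) : set_system X :=
  complements (Sigma1 n X).

Arguments Pi1 : clear implicits.

(* Main.v *)
(** A set B is in Sigma^1_(k+1) when it is the projection of the complement of a
    Sigma^1_k set, which by induction is the range of some continuous g on N<k>.
    That z avoids the range of g is witnessed by a continuous w : N<k> -> nat, with
    w y the least digit at which g y and z differ, and w is correct as soon as it
    is correct on a countable dense set. So B is the image of an intersection of
    countably many clopen subsets of N<k+1>, and a Baire-valued continuous function
    on such an intersection extends to the whole space with the same range: follow
    it until some clopen test fails, then continue with a fixed admissible value.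

    Conversely, points of N<k> have names in the Baire space (Kleene associates);
    the set of names is Sigma^1_k, and convergence of points corresponds to
    convergence of names. The range of f : N<k> -> Baire is then the projection of
    the graph of f composed with the naming, which is relatively closed. *)
Require Import Defs.
From mathcomp Require Import all_boot all_order all_algebra all_classical.
From mathcomp Require Import reals topology.

Set Implicit Arguments.
Unset Strict Implicit.
Unset Printing Implicit Defensive.

Local Open Scope classical_set_scope.

(** * Convergence in the Baire space and in exponentials *)

Lemma nat_cvgP (T : Type) (F : set_system T) (f : T -> nat) (a : nat) :
  Filter F -> f @ F --> a <-> \forall t \near F, f t = a.
Proof.
move=> FF; split=> [h|h A].
  by apply: (h [set a]); rewrite nbhs_principalE; exact/principal_filterP.
rewrite nbhs_principalE => /principal_filterP Aa.
by apply: filterS h => t /= ->.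
Qed.

Lemma nbhs_nat1 (a : nat) : nbhs a [set a].
Proof. by apply: open_nbhs_nbhs; split => //; exact: discrete_open. Qed.

Lemma continuous_from_nat (X : topologicalType) (f : nat -> X) : continuous f.
Proof.
move=> n A /nbhs_singleton An; change (nbhs n (f @^-1` A)).
by apply: (@filterS _ (nbhs n) _ [set n]); [move=> m -> | exact: nbhs_nat1].
Qed.

Lemma continuous_natP (X : topologicalType) (f : X -> nat) :
  continuous f <-> forall x, \forall y \near x, f y = f x.
Proof.
split=> h x; first by have /nat_cvgP := h x.
by apply/nat_cvgP; exact: h.
Qed.

Lemma baire_cvgP (T : Type) (F : set_system T) (f : T -> Baire) (x : Baire) :
  Filter F -> f @ F --> x <-> forall i, \forall t \near F, f t i = x i.
Proof.
move=> FF; split=> [h i|h].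
  apply/(@nat_cvgP _ F (fun t => f t i)).
  apply: (@cvg_comp _ _ _ f (fun y : Baire => y i) F (nbhs x)) => //.
  exact: (@proj_continuous nat (fun=> nat) i x).
apply/cvg_sup => i A [B [[C oC <-] Cx BA]].
by apply: filterS (h i) => t /= e; apply: BA; rewrite /= e.
Qed.

Lemma continuous_baireP (X : topologicalType) (f : X -> Baire) :
  continuous f <-> forall x i, \forall y \near x, f y i = f x i.
Proof.
split=> h x; first by have /baire_cvgP := h x.
by apply/baire_cvgP; exact: h.
Qed.

Definition agree (n : nat) (x y : Baire) := forall i, (i < n)%N -> x i = y i.

Lemma near_all (T : Type) (F : set_system T) (P : nat -> set T) (n : nat) :
  Filter F -> (forall i, \forall t \near F, P i t) ->
  \forall t \near F, forall i, (i < n)%N -> P i t.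
Proof.
move=> FF h; elim: n => [|n IH]; first by apply: nearW.
apply: filterS2 (h n) IH => t Pn IHt i.
by rewrite ltnS leq_eqVlt => /orP[/eqP-> //|/IHt].
Qed.

Lemma near_agree (T : Type) (F : set_system T) {FF : Filter F} (f : T -> Baire)
    (x : Baire) n :
  f @ F --> x -> \forall t \near F, agree n (f t) x.
Proof. by move=> /baire_cvgP h; exact: near_all. Qed.

Lemma agree_cvg (u : nat -> Baire) (x : Baire) :
  (forall n, agree n (u n) x) -> u @ \oo --> x.
Proof. by move=> h; apply/baire_cvgP => i; exists i.+1 => // n /= ni; exact: h. Qed.

Lemma nbhs_agree (x : Baire) (A : set Baire) :
  nbhs x A <-> exists n, forall y, agree n y x -> A y.
Proof.
split=> [xA|[n h]]; last first.
  by apply: (filterS h); exact: (near_agree n (@cvg_id _ (nbhs x))).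
apply: contrapT => h.
have /choice[u uP] n : exists y, agree n y x /\ ~ A y.
  apply: contrapT => h'; apply: h; exists n => y yx.
  by apply: contrapT => nAy; apply: h'; exists y.
have /(_ A xA)[N _ /(_ N (leqnn N))] : u @ \oo --> x.
  by apply: agree_cvg => n; case: (uP n).
by case: (uP N).
Qed.

Definition sequential (X : topologicalType) :=
  forall A : set X, seq_open A -> open A.

Lemma sequential_continuous (X Y : topologicalType) (f : X -> Y) :
  sequential X ->
  (forall (u : nat -> X) x, u @ \oo --> x -> f \o u @ \oo --> f x) ->
  continuous f.
Proof.
move=> sX h; apply/continuousP => A oA; apply: sX => u x Ax ux.
by apply: (h u x ux); exact: open_nbhs_nbhs.
Qed.

(** A sequentially open set eventually contains, by definition, every sequence converging to one of
    its points, so the finer topology keeps the same convergent sequences. *)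
Lemma sequentialization_cvgP (X : topologicalType) (u : nat -> X) (x : X) :
  (u : nat -> sequentialization X) @ \oo --> (x : sequentialization X) <->
  u @ \oo --> x.
Proof.
split=> [h A|h A].
  rewrite nbhsE => -[B [oB Bx] BA]; apply: (h A).
  exists B; split => // v y By vy.
  by apply: vy; exact: open_nbhs_nbhs.
move=> [B [oB Bx BA]].
by apply: filterS (oB u x Bx h) => n /= /BA.
Qed.

Lemma sequentialization_sequential (X : topologicalType) :
  sequential (sequentialization X).
Proof.
move=> A sA; change (@seq_open X A) => u x Ax.
by move=> /sequentialization_cvgP; exact: sA.
Qed.

Lemma initial_cvgP (S : choiceType) (T : topologicalType) (f : S -> T)
    (F : set_system S) (x : S) : Filter F ->
  F --> (x : initial_topology f) <-> f @ F --> f x.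
Proof.
move=> FF; split=> [h|h A [B [[C oC <-] Cx BA]]].
  by apply: (cvg_comp id f h); exact: initial_continuous.
have FC : F (f @^-1` C) by apply: (h C); exact: open_nbhs_nbhs.
by apply: filterS FC => t /= /BA.
Qed.

Section Exp.
Variables (X : topologicalType).
Implicit Types (u : nat -> qcb_exp X nat) (F G : qcb_exp X nat).

Definition ev (F : qcb_exp X nat) : X -> nat := (F : continuousType X nat).

Lemma ev_continuous (F : qcb_exp X nat) : continuous (ev F).
Proof. exact: (@cts_fun _ _ (F : continuousType X nat)). Qed.

Definition exp_of (f : X -> nat) (cf : continuous f) : qcb_exp X nat :=
  (mkcts cf : continuousType X nat).

Lemma ev_inj (F G : qcb_exp X nat) : ev F =1 ev G -> F = G.
Proof. by move=> h; exact/(@continuousEP X nat). Qed.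

Lemma exp_sequential : sequential (qcb_exp X nat).
Proof. exact: sequentialization_sequential. Qed.

Lemma exp_cvgP u F : u @ \oo --> F <->
  forall (K : set X) (O : set nat), compact K -> ev F @` K `<=` O ->
   \forall n \near \oo, ev (u n) @` K `<=` O.
Proof.
split.
  move=> /sequentialization_cvgP/initial_cvgP/compact_open_cvgP h K O cK.
  by apply: h => //; exact: discrete_open.
move=> h; apply/sequentialization_cvgP/initial_cvgP/compact_open_cvgP.
by move=> K O cK _; exact: h.
Qed.
End Exp.

(** * Closure properties of the projective classes *)

Lemma continuous_pair (X Y Z : topologicalType) (f : X -> Y) (g : X -> Z) :
  continuous f -> continuous g -> continuous (fun x => (f x, g x)).
Proof. by move=> cf cg x; apply: cvg_pair; [exact: cf | exact: cg]. Qed.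

Lemma continuous_fst (X Y : topologicalType) : continuous (@fst X Y).
Proof. by move=> x; exact: cvg_fst. Qed.

Lemma continuous_snd (X Y : topologicalType) : continuous (@snd X Y).
Proof. by move=> x; exact: cvg_snd. Qed.

Lemma continuous_comp_fun (X Y Z : topologicalType) (f : X -> Y) (g : Y -> Z) :
  continuous f -> continuous g -> continuous (fun x => g (f x)).
Proof.
by move=> cf cg x; apply: (@continuous_comp _ _ _ f g); [exact: cf | exact: cg].
Qed.

(** * Pairing on [nat] and on the Baire space *)

Definition npair (a b : nat) : nat := pickle (a, b).
Definition nunpair (n : nat) : nat * nat := odflt (0, 0) (unpickle n).

Lemma npairK a b : nunpair (npair a b) = (a, b).
Proof. by rewrite /nunpair /npair pickleK. Qed.

Definition bpair (z : Baire * Baire) : Baire := fun n => npair (z.1 n) (z.2 n).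
Definition bfst (p : Baire) : Baire := fun n => (nunpair (p n)).1.
Definition bsnd (p : Baire) : Baire := fun n => (nunpair (p n)).2.

Lemma bfstK z : bfst (bpair z) = z.1.
Proof. by apply/funext => n; rewrite /bfst /bpair npairK. Qed.

Lemma bsndK z : bsnd (bpair z) = z.2.
Proof. by apply/funext => n; rewrite /bsnd /bpair npairK. Qed.

Lemma near_coord (x : Baire) i : \forall y \near x, y i = x i.
Proof. by have /baire_cvgP := @cvg_id _ (nbhs x); apply. Qed.

Lemma bfst_continuous : continuous bfst.
Proof.
apply/continuous_baireP => x i.
by apply: filterS (near_coord x i) => y; rewrite /bfst => ->.
Qed.

Lemma bsnd_continuous : continuous bsnd.
Proof.
apply/continuous_baireP => x i.
by apply: filterS (near_coord x i) => y; rewrite /bsnd => ->.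
Qed.

Lemma bpair_continuous : continuous bpair.
Proof.
apply/continuous_baireP => x i.
have h1 : \forall z \near x, z.1 i = x.1 i.
  by have /continuous_baireP := @continuous_fst Baire Baire; apply.
have h2 : \forall z \near x, z.2 i = x.2 i.
  by have /continuous_baireP := @continuous_snd Baire Baire; apply.
by apply: filterS2 h1 h2 => z; rewrite /bpair => -> ->.
Qed.

Lemma bfst_fst_continuous (X : topologicalType) :
  continuous (fun z : Baire * X => bfst z.1).
Proof. exact: continuous_comp_fun (@continuous_fst _ _) bfst_continuous. Qed.

Lemma bsnd_fst_continuous (X : topologicalType) :
  continuous (fun z : Baire * X => bsnd z.1).
Proof. exact: continuous_comp_fun (@continuous_fst _ _) bsnd_continuous. Qed.

(** These properties pass through projection and complement, so one induction on the level yields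
    them for all projective classes. Open and closed sets occur together because complement
    exchanges them. *)
Record pointclass (F : forall X : topologicalType, set_system X) : Prop := {
  pc_preimage : forall (X Y : topologicalType) (f : X -> Y) (A : set Y),
    continuous f -> F Y A -> F X (f @^-1` A);
  pc_setI : forall (X : topologicalType) (A B : set X),
    F X A -> F X B -> F X (A `&` B);
  pc_setU : forall (X : topologicalType) (A B : set X),
    F X A -> F X B -> F X (A `|` B);
  pc_open : forall (X : topologicalType) (A : set X), open A -> F X A;
  pc_closed : forall (X : topologicalType) (A : set X), closed A -> F X A }.

(** Membership becomes a countable conjunction of closed-or-open conditions, on which Boolean
    operations act by reindexing. *)
Lemma Pi02P (X : topologicalType) (A : set X) : Pi02 X A <->
  exists C V : nat -> set X,
   [/\ forall i, closed (C i), forall i, open (V i) &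
       forall x, A x <-> forall i, C i x \/ V i x].
Proof.
split=> [[U [V [oU oV ->]]]|[C [V [cC oV AE]]]].
  exists (fun i => ~` U i), V; split=> // [i|x]; first exact: open_closedC.
  split=> [h i|h [i _ [Ux nVx]]]; last by case: (h i).
  by apply: contrapT => /not_orP[/contrapT Ux nVx]; apply: h; exists i.
exists (fun i => ~` C i), V; split=> // [i|]; first exact: closed_openC.
apply/seteqP; split=> x; rewrite AE.
  by move=> h [i _ [Cx Vx]]; case: (h i).
move=> h i; apply: contrapT => /not_orP[nC nV].
by apply: h; exists i.
Qed.

Lemma pointclass_Pi02 : pointclass Pi02.
Proof.
split.
- move=> X Y f A cf /Pi02P[C [V [cC oV AE]]]; apply/Pi02P.
  exists (fun i => f @^-1` C i), (fun i => f @^-1` V i); split=> [i|i|x].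
  + exact: preimage_closed.
  + exact: open_comp.
  + exact: AE.
- move=> X A B /Pi02P[C [V [cC oV AE]]] /Pi02P[C' [V' [cC' oV' BE]]].
  apply/Pi02P.
  exists (fun i => if odd i then C i./2 else C' i./2),
    (fun i => if odd i then V i./2 else V' i./2); split=> [i|i|x].
  + by case: ifP.
  + by case: ifP.
  + split=> [[/AE Ax /BE Bx] i|h]; first by case: ifP.
    split; [apply/AE => i; have := h i.*2.+1 | apply/BE => i; have := h i.*2].
      by rewrite /= odd_double /= uphalf_double.
    by rewrite odd_double doubleK.
- move=> X A B /Pi02P[C [V [cC oV AE]]] /Pi02P[C' [V' [cC' oV' BE]]].
  apply/Pi02P.
  (* Distributivity: a union of two countable intersections is the intersection, over all pairs of
     indices, of the pairwise unions. *)
  exists (fun i => C (nunpair i).1 `|` C' (nunpair i).2),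
    (fun i => V (nunpair i).1 `|` V' (nunpair i).2); split=> [i|i|x].
  + exact: closedU.
  + exact: openU.
  + split=> [[/AE Ax i|/BE Bx i]|h].
    * by case: (Ax (nunpair i).1) => ?; [left|right]; left.
    * by case: (Bx (nunpair i).2) => ?; [left|right]; right.
    * apply: contrapT => /not_orP[nA nB].
      have [i /not_orP[nC nV]] : exists i, ~ (C i x \/ V i x).
        by apply/existsNP => h'; apply: nA; apply/AE.
      have [j /not_orP[nC' nV']] : exists i, ~ (C' i x \/ V' i x).
        by apply/existsNP => h'; apply: nB; apply/BE.
      by have := h (npair i j); rewrite npairK /= => -[[]|[]].
- move=> X A oA; apply/Pi02P; exists (fun=> set0), (fun=> A).
  split=> [i|//|x]; first exact: closed0.
  by split=> [Ax i|/(_ 0%N)[]//]; right.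
- move=> X A cA; apply/Pi02P; exists (fun=> A), (fun=> set0).
  split=> [//|i|x]; first exact: open0.
  by split=> [Ax i|/(_ 0%N)[]//]; left.
Qed.

Lemma pointclass_compl F : pointclass F -> pointclass (fun X => complements (F X)).
Proof.
move=> pF; split.
- move=> X Y f _ cf [A FA <-]; exists (f @^-1` A) => //.
  exact: pc_preimage cf FA.
- move=> X _ _ [A FA <-] [B FB <-]; exists (A `|` B); first exact: pc_setU.
  by rewrite setCU.
- move=> X _ _ [A FA <-] [B FB <-]; exists (A `&` B); first exact: pc_setI.
  by rewrite setCI.
- move=> X A oA; exists (~` A); last by rewrite setCK.
  by apply: pc_closed => //; exact: open_closedC.
- move=> X A oA; exists (~` A); last by rewrite setCK.
  by apply: pc_open => //; exact: closed_openC.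
Qed.

Lemma pc_dummy F (X : topologicalType) (A : set X) : pointclass F -> F X A ->
  [set pr B | B in F (Baire * X)%type] A.
Proof.
move=> pF FA; exists (snd @^-1` A).
  by apply: pc_preimage FA => //; exact: continuous_snd.
by apply/seteqP; split=> x /= => [[]//|Ax]; exists (fun=> 0%N).
Qed.

(** For intersections the two witnesses are merged by pairing; for unions the witness of either side
    serves as it is. *)
Lemma pointclass_pr F :
  pointclass F -> pointclass (fun X => [set pr A | A in F (Baire * X)%type]).
Proof.
move=> pF; split.
- move=> X Y f _ cf [A FA <-].
  exists ((fun z : Baire * X => (z.1, f z.2)) @^-1` A) => //.
  apply: pc_preimage FA => //; apply: continuous_pair.
    exact: continuous_fst.
  exact: continuous_comp_fun (@continuous_snd _ _) cf.
- move=> X _ _ [A FA <-] [B FB <-].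
  exists ((fun z : Baire * X => (bfst z.1, z.2)) @^-1` A `&`
          (fun z : Baire * X => (bsnd z.1, z.2)) @^-1` B).
    apply: pc_setI => //; [apply: pc_preimage FA|apply: pc_preimage FB] => //.
      exact: continuous_pair (@bfst_fst_continuous _) (@continuous_snd _ _).
    exact: continuous_pair (@bsnd_fst_continuous _) (@continuous_snd _ _).
  apply/seteqP; split=> x /=; first by move=> [p [/= Ax Bx]]; split; eexists; eauto.
  move=> [[p Ax] [q Bx]]; exists (bpair (p, q)) => /=.
  by rewrite bfstK bsndK.
- move=> X _ _ [A FA <-] [B FB <-]; exists (A `|` B); first exact: pc_setU.
  apply/seteqP; split=> x /=; first by move=> [p [Ax|Bx]]; [left|right]; exists p.
  by move=> [[p Ax]|[p Bx]]; exists p; [left|right].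
- by move=> X A oA; apply: (pc_dummy pF); exact: pc_open.
- by move=> X A oA; apply: (pc_dummy pF); exact: pc_closed.
Qed.

(** The class whose projections form level [n.+1]. It makes the first level, built on [Pi02], an
    instance of the same recursion as the later ones. *)
Definition Sigma1_matrix (n : nat) (X : topologicalType) : set_system X :=
  if n is _.+1 then Pi1 n X else Pi02 X.

Lemma Sigma1S n (X : topologicalType) :
  Sigma1 n.+1 X = [set pr A | A in @Sigma1_matrix n (Baire * X)%type].
Proof. by case: n. Qed.

Lemma pointclass_matrix n : pointclass (@Sigma1_matrix n).
Proof.
elim: n => [|[|n] IH]; first exact: pointclass_Pi02.
  exact: pointclass_compl (pointclass_pr IH).
exact: pointclass_compl (pointclass_pr IH).
Qed.

Lemma pointclass_Sigma1 n : pointclass (Sigma1 n.+1).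
Proof.
case: n => [|n]; first exact (pointclass_pr (pointclass_matrix 0)).
exact (pointclass_pr (pointclass_matrix n.+1)).
Qed.

Lemma Sigma1_setC n (X : topologicalType) (A : set X) :
  Sigma1 n.+1 X A -> Sigma1 n.+2 X (~` A).
Proof.
move=> SA; rewrite Sigma1S; apply: (pc_dummy (pointclass_matrix n.+1)).
by exists A.
Qed.

(** Two successive quantifiers over the Baire space contract to one through pairing. *)
Lemma Sigma1_pr n (X : topologicalType) (A : set (Baire * X)) :
  Sigma1 n.+1 (Baire * X)%type A -> Sigma1 n.+1 X (pr A).
Proof.
rewrite !Sigma1S => -[B FB <-].
exists ((fun z : Baire * X => (bfst z.1, (bsnd z.1, z.2))) @^-1` B).
  apply: pc_preimage FB; first exact: pointclass_matrix.
  apply: continuous_pair; last apply: continuous_pair.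
  - exact: bfst_fst_continuous.
  - exact: bsnd_fst_continuous.
  - exact: continuous_snd.
apply/seteqP; split=> x /=.
  by move=> [p Bx]; exists (bsnd p), (bfst p).
by move=> [p [q Bx]]; exists (bpair (q, p)); rewrite /= bfstK bsndK.
Qed.

(** * Sequential compactness and continuous convergence *)

(** Subsequences are taken along any [phi] with [n <= phi n], monotone or not: such a [phi] tends to
    infinity, which is what [subseq_cvg] rests on. *)
Lemma not_near_oo (P : set nat) : ~ (\forall n \near \oo, P n) ->
  exists phi : nat -> nat, forall n, (n <= phi n)%N /\ ~ P (phi n).
Proof.
move=> h; suff /choice[phi hphi] N : exists n, (N <= n)%N /\ ~ P n by exists phi.
apply: contrapT => h'; apply: h; exists N => // n /= Nn.
by apply: contrapT => nP; apply: h'; exists n.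
Qed.

Lemma subseq_cvg (X : topologicalType) (u : nat -> X) (x : X) (phi : nat -> nat) :
  (forall n, (n <= phi n)%N) -> u @ \oo --> x -> (u \o phi) @ \oo --> x.
Proof.
move=> h ux A /ux [N _ NA]; exists N => // n /= Nn.
by apply: NA => /=; exact: leq_trans (h n).
Qed.

(** A proper filter on this set that does not cluster at [x] avoids a neighbourhood of [x], hence
    lives on finitely many terms of [u], and finite sets are compact. *)
Lemma compact_cvg_range (X : topologicalType) (u : nat -> X) (x : X) :
  u @ \oo --> x -> compact (x |` range u).
Proof.
move=> ux F PF FK.
have [cx|ncx] := pselect (cluster F x); first by exists x; split => //; left.
have [A [B [FA xB AB]]] : exists A B, [/\ F A, nbhs x B & ~ (A `&` B !=set0)].
  apply: contrapT => h; apply: ncx => A B FA xB; apply: contrapT => AB.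
  by apply: h; exists A, B.
have [N _ NB] := ux B xB.
have /(@finite_compact X) cS : finite_set (u @` `I_N).
  exact: finite_image (finite_II N).
have FS : F (u @` `I_N).
  apply: filterS2 FA FK => y Ay [yx|[n _ yu]].
    by exfalso; apply: AB; exists y; split => //; rewrite yx; exact: nbhs_singleton.
  exists n => //=; rewrite ltnNge; apply/negP => Nn.
  by apply: AB; exists y; split => //; rewrite -yu; exact: NB.
have [y [[n _ <-] cy]] := cS F PF FS.
by exists (u n); split => //; right; exists n.
Qed.

(** The limit may lie outside [K]: [exp_cvg_intro] uses it only as a point at which functions are
    compared. *)
Definition seq_compact (X : topologicalType) := forall K : set X, compact K ->
  forall u : nat -> X, (forall n, K (u n)) ->
  exists phi : nat -> nat, (forall n, (n <= phi n)%N) /\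
  exists x : X, (u \o phi) @ \oo --> x.

Definition separable_space (X : topologicalType) :=
  exists d : nat -> X, forall U : set X, open U -> U !=set0 -> exists n, U (d n).

Lemma compact_cluster_seq (X : topologicalType) (K : set X) (u : nat -> X) :
  compact K -> (forall n, K (u n)) -> K `&` cluster (u @ \oo) !=set0.
Proof.
move=> cK Ku; apply: cK.
by exists 0%N => // n _; exact: Ku.
Qed.

Lemma seq_compact_nat : seq_compact nat.
Proof.
move=> K cK u Ku.
have [x [Kx cx]] : K `&` cluster (u @ \oo) !=set0 by exact: compact_cluster_seq.
have /choice[phi hphi] n : exists m, (n <= m)%N /\ u m = x.
  have [||_ [[m /= nm <-] e]] := cx (u @` [set m | (n <= m)%N]) [set x].
  - by exists n => // m /= nm; exists m.
  - exact: nbhs_nat1.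
  - by exists m.
exists phi; split; first by move=> n; case: (hphi n).
by exists x; apply/nat_cvgP; apply: nearW => n; case: (hphi n).
Qed.

Section Exp.
Variables (X : topologicalType).
Implicit Types (u : nat -> qcb_exp X nat) (F G : qcb_exp X nat).

(** Continuous convergence: [x] and a tail of [xi] on which [ev F] already has its limit value form
    a compact set, and [u n] eventually takes that value on all of it. *)
Lemma exp_cvg_ev u F (xi : nat -> X) (x : X) : u @ \oo --> F -> xi @ \oo --> x ->
  \forall n \near \oo, ev (u n) (xi n) = ev F x.
Proof.
move=> /exp_cvgP uF xix.
have [N _ hN] : \forall n \near \oo, ev F (xi n) = ev F x.
  apply/(@nat_cvgP _ \oo (ev F \o xi)).
  exact: cvg_comp xix (@ev_continuous _ F x).
have xNx : (xi \o addn N) @ \oo --> x by apply: subseq_cvg => // n; exact: leq_addl.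
have [|M _ hM] := uF _ [set ev F x] (compact_cvg_range xNx).
  move=> _ [y [->|[n _ <-]] <-] //=; apply: hN => /=; exact: leq_addr.
exists (maxn N M) => // n /=; rewrite geq_max => /andP[Nn Mn].
apply: (hM n Mn); exists (xi n) => //; right; exists (n - N)%N => //=.
by rewrite subnKC.
Qed.

Lemma ev_at_continuous (x : X) : continuous (fun F : qcb_exp X nat => ev F x).
Proof.
apply: (sequential_continuous (@exp_sequential X)) => u F uF.
apply/(@nat_cvgP _ \oo ((fun F : qcb_exp X nat => ev F x) \o u)).
by apply: exp_cvg_ev uF _; exact: cvg_cst.
Qed.

(** Converse of [exp_cvg_ev]. If convergence failed for some [K] and [O], bad points of [K] would
    have a convergent subsequence, along which [u] and [F] must agree. The reindexing [psi] is there
    because failure shows only at some indices. *)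
Lemma exp_cvg_intro u F : seq_compact X ->
  (forall (psi : nat -> nat) (xi : nat -> X) (x : X), (forall n, (n <= psi n)%N) ->
    xi @ \oo --> x -> \forall n \near \oo, ev (u (psi n)) (xi n) = ev F x) ->
  u @ \oo --> F.
Proof.
move=> scX h; apply/exp_cvgP => K O cK KO; apply: contrapT => /not_near_oo[psi].
move=> psiP.
have /choice[xi xiP] n : exists x, K x /\ ~ O (ev (u (psi n)) x).
  apply: contrapT => h'; case: (psiP n) => _; apply => _ [x Kx <-].
  by apply: contrapT => nO; apply: h'; exists x.
have [n|phi [phiP [x xix]]] := scX K cK xi; first by case: (xiP n).
have psiphi n : (n <= psi (phi n))%N.
  by apply: leq_trans (phiP n) _; case: (psiP (phi n)).
have h1 := h (psi \o phi) (xi \o phi) x psiphi xix.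
have h2 : \forall n \near \oo, ev F (xi (phi n)) = ev F x.
  apply/(@nat_cvgP _ \oo (ev F \o (xi \o phi))).
  exact: cvg_comp xix (@ev_continuous _ F x).
have [n [/= e1 e2]] := filter_ex (filterI h1 h2).
case: (xiP (phi n)) => Kx; apply; rewrite e1 -e2.
by apply: KO; exists (xi (phi n)).
Qed.

Lemma ev_dense_inj (d : nat -> X) F G :
  (forall U : set X, open U -> U !=set0 -> exists n, U (d n)) ->
  (forall n, ev F (d n) = ev G (d n)) -> F = G.
Proof.
move=> dd h; apply: ev_inj => x; apply: contrapT => ne.
have [n] : exists n, [set y | ev F y <> ev G y] (d n).
  apply: dd; last by exists x.
  rewrite openE => y /= FGy.
  have /continuous_natP/(_ y) Fy := @ev_continuous _ F.
  have /continuous_natP/(_ y) Gy := @ev_continuous _ G.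
  by apply: filterS2 Fy Gy => z /= -> ->.
by move=> /(_ (h n)).
Qed.

(** Choose a subsequence agreeing with a cluster point [F] on ever more points of the dense sequence
    [d]. If it avoided a neighbourhood of [F] infinitely often, those terms would cluster at some
    [G] that equals [F] on [d], hence everywhere. *)
Lemma seq_compact_exp : separable_space X -> seq_compact (qcb_exp X nat).
Proof.
move=> [d dd] K cK u Ku.
have [F [KF cF]] : K `&` cluster (u @ \oo) !=set0 by exact: compact_cluster_seq.
have near_d (G : qcb_exp X nat) i : \forall H \near G, ev H (d i) = ev G (d i).
  by have /continuous_natP := @ev_at_continuous (d i); apply.
have /choice[phi phiP] n : exists m, (n <= m)%N /\
    forall i, (i < n)%N -> ev (u m) (d i) = ev F (d i).
  have [||_ [[m /= nm <-] e]] := cF (u @` [set m | (n <= m)%N])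
    [set G | forall i, (i < n)%N -> ev G (d i) = ev F (d i)].
  - by exists n => // m /= nm; exists m.
  - apply: (@near_all _ (nbhs F) (fun i G => ev G (d i) = ev F (d i))) => i.
    exact: near_d.
  - by exists m.
exists phi; split; first by move=> n; case: (phiP n).
exists F => A FA; apply: contrapT => /not_near_oo[psi psiP].
have [G [KG cG]] : K `&` cluster ((u \o (phi \o psi)) @ \oo) !=set0.
  by apply: compact_cluster_seq => // n; exact: Ku.
have tail N : ((u \o (phi \o psi)) @ \oo)
    ((u \o (phi \o psi)) @` [set m | (N <= m)%N]).
  by exists N => // m /= nm; exists m.
have GF : G = F.
  apply: (ev_dense_inj dd) => i.
  have [_ [[m /= im <-] <-]] := cG _ _ (tail i.+1) (near_d G i).
  case: (phiP (psi m)) => _; apply.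
  by apply: leq_trans im _; case: (psiP m).
have [_ [[m /= _ <-] Am]] := cG _ A (tail 0%N) ltac:(by rewrite GF).
by case: (psiP m).
Qed.

End Exp.

(** * Names of points *)

Lemma cvg_map (X Y : topologicalType) (f : X -> Y) (u : nat -> X) (x : X) :
  continuous f -> u @ \oo --> x -> (f \o u) @ \oo --> f x.
Proof. by move=> cf ux; exact: cvg_comp ux (cf x). Qed.

Lemma closure_cvg (W : set (Baire * Baire)) z : closure W z ->
  exists w : nat -> Baire * Baire, (forall n, W (w n)) /\ w @ \oo --> z.
Proof.
move=> cz.
have /choice[w wP] n :
    exists w, [/\ W w, agree n w.1 z.1 & agree n w.2 z.2].
  have [|w [Ww [a1 a2]]] := cz [set w | agree n w.1 z.1 /\ agree n w.2 z.2].
    apply: filterI.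
      exact: (near_agree n (@continuous_fst Baire Baire z)).
    exact: (near_agree n (@continuous_snd Baire Baire z)).
  by exists w.
exists w; split=> [n|]; first by case: (wP n).
have h1 : (fun n => (w n).1) @ \oo --> (z.1 : Baire).
  by apply: agree_cvg => n; case: (wP n).
have h2 : (fun n => (w n).2) @ \oo --> (z.2 : Baire).
  by apply: agree_cvg => n; case: (wP n).
rewrite (_ : w = fun n => ((w n).1, (w n).2)); first exact: cvg_pair h1 h2.
by apply/funext => n; exact: surjective_pairing.
Qed.

(** The hypothesis says that [W] is closed relative to [C], that is, [W] is [C] intersected with the
    closure of [W], since closure points in [Baire * Baire] are limits of sequences. *)
Lemma pc_seq_closed F (W C : set (Baire * Baire)) : pointclass F ->
  W `<=` C -> F (Baire * Baire)%type C ->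
  (forall w z, (forall n, W (w n)) -> w @ \oo --> z -> C z -> W z) ->
  F (Baire * Baire)%type W.
Proof.
move=> pF WC FC h; rewrite (_ : W = C `&` closure W).
  by apply: pc_setI => //; apply: pc_closed => //; exact: closed_closure.
apply/seteqP; split=> z.
  by move=> Wz; split; [exact: WC | exact: subset_closure].
by move=> [Cz /closure_cvg[w [Ww wz]]]; exact: h wz Cz.
Qed.

(** * Coded prefixes and Kleene application *)

Definition code (n : nat) (x : Baire) : nat := pickle (mkseq x n).

Lemma code_inj n m x y : code n x = code m y -> n = m /\ agree n x y.
Proof.
move/(pcan_inj pickleK) => e.
have nm : n = m by rewrite -(size_mkseq x n) e size_mkseq.
split=> // i i_n; move/(congr1 (fun s => nth 0%N s i)): e.
by rewrite !nth_mkseq -?nm.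
Qed.

Lemma agree_code n m x y : agree n x y -> (m <= n)%N -> code m x = code m y.
Proof.
move=> a mn; rewrite /code; congr pickle; apply/eq_in_map => i.
by rewrite mem_iota => /= im; apply: a; exact: leq_trans mn.
Qed.

(* Kleene's application [alpha | x]: the first nonzero entry of [alpha] along the
   prefixes of [x] is the answer plus one. *)
Definition app (alpha x : Baire) (v : nat) : Prop :=
  exists m, alpha (code m x) = v.+1 /\
    forall i, (i < m)%N -> alpha (code i x) = 0%N.

Lemma app_fun alpha x v w : app alpha x v -> app alpha x w -> v = w.
Proof.
move=> [m [hm m0]] [n [hn n0]]; case: (ltngtP m n) => mn.
- by move: (n0 m mn); rewrite hm.
- by move: (m0 n mn); rewrite hn.
- by move: hn; rewrite -mn hm => -[].
Qed.

(** An answer depends on finitely many entries of [alpha] and a finite prefix of [x]. *)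
Lemma app_near (T : Type) (F : set_system T) {FF : Filter F} (f g : T -> Baire)
    alpha x v :
  f @ F --> alpha -> g @ F --> x -> app alpha x v ->
  \forall t \near F, app (f t) (g t) v.
Proof.
move=> fa gx [m [hm m0]].
have near_f : \forall t \near F, forall i, (i < m.+1)%N ->
    f t (code i x) = alpha (code i x).
  by apply: near_all => i; move/baire_cvgP: fa; apply.
apply: filterS2 near_f (near_agree m gx) => t ft gt.
exists m; split; first by rewrite (agree_code gt) // ft.
by move=> i im; rewrite (agree_code gt) ?ft ?m0 //; exact: ltnW.
Qed.

Lemma app_exists alpha x m : alpha (code m x) <> 0%N -> exists v, app alpha x v.
Proof.
move=> am; have ex : exists m, alpha (code m x) != 0%N by exists m; exact/eqP.
case: (ex_minnP ex) => n an nmin.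
exists (alpha (code n x)).-1, n; split; first by rewrite prednK // lt0n.
move=> i i_n; apply/eqP; apply: contraTT i_n => ai.
by rewrite -leqNgt; exact: nmin.
Qed.

(* [R p x] reads "p is a name of x". *)
Record name_rel (X : topologicalType) (R : Baire -> X -> Prop) : Prop := {
  name_cont : forall (a : nat -> Baire) (p : Baire) (u : nat -> X) (x : X),
    (forall n, R (a n) (u n)) -> R p x -> a @ \oo --> p -> u @ \oo --> x;
  name_lift : forall (u : nat -> X) (x : X), u @ \oo --> x ->
    exists (a : nat -> Baire) (p : Baire),
      [/\ forall n, R (a n) (u n), R p x & a @ \oo --> p] }.

Definition names (X : Type) (R : Baire -> X -> Prop) : set Baire :=
  [set p | exists x, R p x].

Section Names.
Variables (X : topologicalType) (R : Baire -> X -> Prop).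
Hypothesis nR : name_rel R.

Lemma name_surj x : exists p, R p x.
Proof. by have [a [p [_ Rp _]]] := name_lift nR (cvg_cst x); exists p. Qed.

(** For each prefix, pick a point with a name in its cylinder, with [x0] as default. Names sharing a
    long prefix with a name of [x] denote points of [U]; otherwise counterexamples would converge to
    [x]. *)
Lemma name_separable (x0 : X) : separable_space X.
Proof.
exists (fun k => xget x0 [set x | exists p, R p x /\ exists n, code n p = k]).
move=> U oU [x Ux]; have [p Rp] := name_surj x.
have [n hn] : exists n, forall q y, agree n q p -> R q y -> U y.
  apply: contrapT => h.
  have /choice[qy qyP] n :
      exists z : Baire * X, [/\ agree n z.1 p, R z.1 z.2 & ~ U z.2].
    apply: contrapT => h'; apply: h; exists n => q y a Rq.
    by apply: contrapT => nU; apply: h'; exists (q, y).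
  have ux : (snd \o qy) @ \oo --> x.
    apply: (name_cont nR (a := fst \o qy) _ Rp) => [n|]; first by case: (qyP n).
    by apply: agree_cvg => n; case: (qyP n).
  have [N _ /(_ N (leqnn N))] := ux U (open_nbhs_nbhs (conj oU Ux)).
  by case: (qyP N).
exists (code n p); set S := [set _ | _].
have [q [Rq [m /code_inj[nm a]]]] : S (xget x0 S).
  by apply: (@xgetPex _ x0); exists x, p; split => //; exists n.
by apply: hn Rq; rewrite -nm.
Qed.

Definition exp_name (alpha : Baire) (F : qcb_exp X nat) : Prop :=
  forall p x, R p x -> app alpha p (ev F x).

(** The hypothesis makes the answer depend on the point alone. The resulting function is
    sequentially continuous because convergent sequences lift to names and answers are locally
    constant. *)
Lemma exp_name_total alpha : sequential X ->
  (forall p q x, R p x -> R q x -> exists v, app alpha p v /\ app alpha q v) ->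
  names exp_name alpha.
Proof.
move=> sX h.
pose f x := xget 0%N [set v | exists p, R p x /\ app alpha p v].
have fP p x : R p x -> app alpha p (f x).
  move=> Rp; have [q [Rq qv]] : [set v | exists p, R p x /\ app alpha p v] (f x).
    by apply: xgetPex; have [v [av _]] := h p p x Rp Rp; exists v, p.
  have [v [pv qv']] := h p q x Rp Rq.
  by rewrite (app_fun qv qv').
have cf : continuous f.
  apply: sequential_continuous => // u x /(name_lift nR)[a [p [Ra Rp ap]]].
  apply/(@nat_cvgP _ \oo (f \o u)).
  apply: filterS (app_near (cvg_cst alpha) ap (fP _ _ Rp)) => n av.
  exact: app_fun (fP _ _ (Ra n)) av.
by exists (exp_of cf).
Qed.

Lemma exp_name_cont (a : nat -> Baire) alpha (u : nat -> qcb_exp X nat) F :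
  seq_compact X -> (forall n, exp_name (a n) (u n)) -> exp_name alpha F ->
  a @ \oo --> alpha -> u @ \oo --> F.
Proof.
move=> scX au aF aalpha; apply: exp_cvg_intro => // psi xi x hpsi.
move=> /(name_lift nR)[b [p [Rb Rp bp]]].
apply: filterS (app_near (subseq_cvg hpsi aalpha) bp (aF _ _ Rp)) => n av.
exact: app_fun (au _ _ _ (Rb n)) av.
Qed.

(* The common associate of a set [G] of functions: it answers on a prefix [s] as
   soon as all functions in [G] take one and the same value on all points named
   in the cylinder of [s]. *)
Definition assoc_answer (G : set (qcb_exp X nat)) (k v : nat) : Prop :=
  forall p x n, code n p = k -> R p x -> forall F, G F -> ev F x = v.

Definition assoc (G : set (qcb_exp X nat)) (k : nat) : nat :=
  if pselect (exists v, assoc_answer G k v) is left _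
  then (xget 0%N [set v | assoc_answer G k v]).+1 else 0%N.

Lemma assocP (G : set (qcb_exp X nat)) k v :
  assoc G k = v.+1 -> assoc_answer G k v.
Proof.
by rewrite /assoc; case: pselect => // ex [<-]; apply: (xgetPex 0%N ex).
Qed.

Lemma assoc_neq0 (G : set (qcb_exp X nat)) k :
  (exists v, assoc_answer G k v) -> assoc G k <> 0%N.
Proof. by rewrite /assoc; case: pselect. Qed.

Lemma exp_name_intro alpha F :
  (forall k v, alpha k = v.+1 -> assoc_answer [set F] k v) ->
  (forall p x, R p x -> exists m, alpha (code m p) <> 0%N) ->
  exp_name alpha F.
Proof.
move=> sound tot p x Rp; have [m /app_exists[v av]] := tot p x Rp.
have [n [hn _]] := av.
by rewrite (sound _ _ hn p x n erefl Rp F erefl).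
Qed.

(** Otherwise ever longer prefixes of [p] carry points, converging to [x], at which [F] or some late
    [u i] differs from [ev F x], against [exp_cvg_ev]. *)
Lemma assoc_total (u : nat -> qcb_exp X nat) F p x : u @ \oo --> F -> R p x ->
  exists n, forall m, (n <= m)%N -> exists v,
    assoc_answer (F |` [set u i | i in [set i | m <= i]%N]) (code m p) v.
Proof.
move=> uF Rp; apply: contrapT => h.
have /choice[w wP] n : exists w : nat * Baire * X,
   [/\ (n <= w.1.1)%N, agree n w.1.2 p, R w.1.2 w.2 &
    ev F w.2 <> ev F x \/ ev (u w.1.1) w.2 <> ev F x].
  apply: contrapT => h'; apply: h; exists n => m nm; exists (ev F x).
  move=> q y k /code_inj[km a] Ry G FG; apply: contrapT => ne.
  have an : agree n q p by move=> i i_n; apply: a; rewrite km; exact: leq_trans nm.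
  case: FG ne => [->|[i mi <-]] ne; apply: h'.
    by exists (n, q, y); split => //; left.
  by exists (i, q, y); split => //; [exact: leq_trans nm mi|right].
have wx : (snd \o w) @ \oo --> x.
  apply: (name_cont nR (a := snd \o fst \o w) _ Rp) => [n|]; first by case: (wP n).
  by apply: agree_cvg => n; case: (wP n).
have h1 : \forall n \near \oo, ev F (w n).2 = ev F x.
  exact: exp_cvg_ev (cvg_cst F) wx.
have h2 : \forall n \near \oo, ev (u (w n).1.1) (w n).2 = ev F x.
  apply: (exp_cvg_ev (u := fun n => u (w n).1.1) _ wx).
  by apply: (subseq_cvg (phi := fun n => (w n).1.1) _ uF) => n; case: (wP n).
have [n [/= e1 e2]] := filter_ex (filterI h1 h2).
by case: (wP n) => _ _ _ [].
Qed.

(** On a prefix of length [m], [alpha] answers only for [F] and all [u i] with [m <= i] at once. So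
    its part up to length [n] is sound for [u n]; [a n] copies that part and continues with the
    associate of [u n] alone. *)
Lemma exp_name_lift (u : nat -> qcb_exp X nat) F : u @ \oo --> F ->
  exists (a : nat -> Baire) (alpha : Baire),
    [/\ forall n, exp_name (a n) (u n), exp_name alpha F & a @ \oo --> alpha].
Proof.
move=> uF.
pose len k := size (odflt [::] (unpickle k : option (seq nat))).
have lenE n p : len (code n p) = n by rewrite /len /code pickleK /= size_mkseq.
pose alpha : Baire := fun k => assoc (F |` [set u i | i in [set i | len k <= i]%N]) k.
pose a n : Baire := fun k => if (len k <= n)%N then alpha k else assoc [set u n] k.
exists a, alpha; split.
- move=> n; apply: exp_name_intro => [k v|p x Rp].
    rewrite /a; case: ifP => kn /assocP aG p x m kp Rp _ ->.
      by apply: (aG p x m kp Rp); right; exists n.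
    exact: aG kp Rp _ erefl.
  have un : (fun=> u n) @ \oo --> u n by exact: cvg_cst.
  have [m hm] := assoc_total un Rp.
  (* A length above [n] is needed, so that the associate of [u n] alone is consulted. *)
  exists (maxn m n.+1); rewrite /a lenE ifN; last by rewrite -ltnNge leq_maxr.
  apply: assoc_neq0; have [v av] := hm (maxn m n.+1) (leq_maxl _ _).
  by exists v => q y k hk Ry _ ->; apply: (av q y k hk Ry); left.
- apply: exp_name_intro => [k v /assocP aG p x m kp Rp _ ->|p x Rp].
    by apply: (aG p x m kp Rp); left.
  have [m hm] := assoc_total uF Rp; exists m; apply: assoc_neq0.
  by rewrite lenE; exact: hm.
- apply/baire_cvgP => k; exists (len k) => // n /= kn.
  by rewrite /a kn.
Qed.

Lemma exp_name_rel : seq_compact X -> name_rel exp_name.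
Proof.
by move=> scX; split=> *; [apply: exp_name_cont; eauto | exact: exp_name_lift].
Qed.

Definition same_name : set (Baire * Baire) :=
  [set z | exists x, R z.1 x /\ R z.2 x].

(** By [exp_name_total], [alpha] names no function exactly when two names of one point receive no
    common answer: two existential quantifiers over [same_name] intersected with a closed set. *)
Lemma exp_names_compl n : sequential X ->
  Sigma1 n.+1 (Baire * Baire)%type same_name ->
  Sigma1 n.+1 Baire (~` names exp_name).
Proof.
move=> sX SE.
pose D : set (Baire * (Baire * Baire)) :=
  [set z | exists v, app z.2.2 z.1 v /\ app z.2.2 z.2.1 v].
have oD : open D.
  have c1 : continuous (fun z : Baire * (Baire * Baire) => z.1).
    exact: continuous_fst.
  have c21 : continuous (fun z : Baire * (Baire * Baire) => z.2.1).
    exact: continuous_comp_fun (@continuous_snd _ _) (@continuous_fst _ _).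
  have c22 : continuous (fun z : Baire * (Baire * Baire) => z.2.2).
    exact: continuous_comp_fun (@continuous_snd _ _) (@continuous_snd _ _).
  rewrite openE => z [v [h1 h2]].
  apply: filterS2 (app_near (c22 z) (c1 z) h1) (app_near (c22 z) (c21 z) h2).
  by move=> y k1 k2; exists v.
pose args (z : Baire * (Baire * Baire)) := (z.1, z.2.1).
rewrite (_ : ~` _ = pr (pr (args @^-1` same_name `&` ~` D))).
  do 2 apply: Sigma1_pr; have pS := pointclass_Sigma1 n.
  apply: (pc_setI pS); last by apply: (pc_closed pS); exact: open_closedC.
  apply: (pc_preimage pS) SE; apply: continuous_pair; first exact: continuous_fst.
  exact: continuous_comp_fun (@continuous_snd _ _) (@continuous_fst _ _).
apply/seteqP; split=> alpha /=.
  move=> h; apply: contrapT => h'; apply: h; apply: exp_name_total => // p q x Rp Rq.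
  apply: contrapT => nv; apply: h'; exists q, p; split; first by exists x.
  by move=> [v [/= v1 v2]]; apply: nv; exists v.
move=> [q [p [[x [/= Rp Rq]] nD]]] [F aF]; apply: nD.
by exists (ev F x); split; exact: aF.
Qed.

End Names.

(** * Complexity of the sets of names and of ranges *)

Lemma exp_lim_unique (X : topologicalType) (u : nat -> qcb_exp X nat)
    (F G : qcb_exp X nat) :
  u @ \oo --> F -> u @ \oo --> G -> F = G.
Proof.
move=> uF uG; apply: ev_inj => x.
have h1 : \forall n \near \oo, ev (u n) x = ev F x.
  exact: exp_cvg_ev uF (cvg_cst x).
have h2 : \forall n \near \oo, ev (u n) x = ev G x.
  exact: exp_cvg_ev uG (cvg_cst x).
by have [n [/= <- <-]] := filter_ex (filterI h1 h2).
Qed.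

Lemma cvg_prod_fst (w : nat -> Baire * Baire) (z : Baire * Baire) :
  w @ \oo --> z -> (fun n => (w n).1) @ \oo --> (z.1 : Baire).
Proof. exact: (@cvg_map _ _ fst) (@continuous_fst _ _). Qed.

Lemma cvg_prod_snd (w : nat -> Baire * Baire) (z : Baire * Baire) :
  w @ \oo --> z -> (fun n => (w n).2) @ \oo --> (z.2 : Baire).
Proof. exact: (@cvg_map _ _ snd) (@continuous_snd _ _). Qed.

(** Uniqueness of limits makes [same_name] relatively closed in the square of the set of names. *)
Lemma Sigma1_same_name (X : topologicalType) (R : Baire -> X -> Prop) n :
  name_rel R ->
  (forall (u : nat -> X) (x y : X), u @ \oo --> x -> u @ \oo --> y -> x = y) ->
  Sigma1 n.+1 Baire (names R) -> Sigma1 n.+1 (Baire * Baire)%type (same_name R).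
Proof.
move=> nR uX SR; have pS := pointclass_Sigma1 n.
apply: (pc_seq_closed (C := fst @^-1` names R `&` snd @^-1` names R) pS).
- by move=> z [x [h1 h2]]; split; exists x.
- apply: (pc_setI pS); apply: (pc_preimage pS) SR.
    exact: continuous_fst.
  exact: continuous_snd.
- move=> w z Ww wz [[x Rx] [y Ry]].
  have /choice[u uP] := Ww.
  have ux : u @ \oo --> x.
    by apply: (name_cont nR _ Rx (cvg_prod_fst wz)) => n'; case: (uP n').
  have uy : u @ \oo --> y.
    by apply: (name_cont nR _ Ry (cvg_prod_snd wz)) => n'; case: (uP n').
  by exists x; split => //; rewrite (uX _ _ _ ux uy).
Qed.

Lemma Sigma1_range (X : topologicalType) (R : Baire -> X -> Prop) n
    (f : X -> Baire) :
  name_rel R -> Sigma1 n.+1 Baire (names R) -> continuous f ->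
  Sigma1 n.+1 Baire (range f).
Proof.
move=> nR SR cf; have pS := pointclass_Sigma1 n.
rewrite (_ : range f = pr [set z | exists x, R z.1 x /\ f x = z.2]); last first.
  apply/seteqP; split=> [_ [x _ <-]|y [p [x /= [_ <-]]]]; last by exists x.
  by have [p Rp] := name_surj nR x; exists p, x.
apply: Sigma1_pr; apply: (pc_seq_closed (C := fst @^-1` names R) pS).
- by move=> z [x [h1 _]]; exists x.
- by apply: (pc_preimage pS) SR; exact: continuous_fst.
- move=> w z Ww wz [x Rx]; have /choice[u uP] := Ww; exists x; split=> //.
  have ux : u @ \oo --> x.
    by apply: (name_cont nR _ Rx (cvg_prod_fst wz)) => n'; case: (uP n').
  have fux := cvg_map cf ux.
  apply/funext => i; move/baire_cvgP/(_ i): fux => h1.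
  move/baire_cvgP/(_ i): (cvg_prod_snd wz) => h2.
  have [m [/= <- <-]] := filter_ex (filterI h1 h2).
  by case: (uP m) => _ ->.
Qed.

(** At the first level a function is its own name, so every [p] is a name and the induction on
    complexity starts from an open set. *)
Definition baire_name (p : Baire) (F : kleene_kreisel 1) : Prop := ev F =1 p.

Lemma baire_name_rel : name_rel baire_name.
Proof.
split=> [a p u F au pF ap|u F uF].
  apply: (exp_cvg_intro seq_compact_nat) => psi xi x hpsi /nat_cvgP xix.
  move/baire_cvgP/(_ x): (subseq_cvg hpsi ap); apply: filterS2 xix => n -> /= e.
  by rewrite au pF.
exists (fun n => ev (u n)), (ev F); split=> //.
apply/baire_cvgP => i.
by apply: (exp_cvg_ev uF); exact: cvg_cst.
Qed.

Lemma continuous_const (X : topologicalType) (c : nat) : continuous (fun _ : X => c).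
Proof. by move=> x; exact: cvg_cst. Qed.

Definition const_exp (X : topologicalType) (c : nat) : qcb_exp X nat :=
  exp_of (@continuous_const X c).

(** Each exponential costs one complement, hence one level. Sequential compactness is carried along
    because [exp_name_rel] asks it of the domain. *)
Lemma kleene_kreisel_names k :
  exists R : Baire -> kleene_kreisel k.+1 -> Prop,
  [/\ name_rel R, Sigma1 k.+1 Baire (names R) & seq_compact (kleene_kreisel k.+1)].
Proof.
elim: k => [|k [R [nR SR sc]]].
  exists baire_name; split; first exact: baire_name_rel.
    apply: (pc_open (pointclass_Sigma1 0)).
    rewrite (_ : names _ = setT); first exact: openT.
    apply/seteqP; split=> // p _.
    by exists (exp_of (@continuous_from_nat _ (p : nat -> nat))).
  apply: seq_compact_exp; exists id => U _ [n Un]; by exists n.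
exists (exp_name R); split.
- exact: exp_name_rel.
- rewrite -[names _]setCK; apply: Sigma1_setC; apply: (exp_names_compl nR).
    exact: exp_sequential.
  apply: Sigma1_same_name => //; exact: exp_lim_unique.
- apply: seq_compact_exp; apply: (name_separable nR).
  exact: (const_exp _ 0%N).
Qed.

(** * Continuous images *)

(** Equivalently, [A] is clopen. *)
Definition locally_constant (X : topologicalType) (A : set X) :=
  forall x, \forall y \near x, A y <-> A x.

Lemma agreeC n x y : agree n x y -> agree n y x.
Proof. by move=> a i /a ->. Qed.

Lemma agree_trans n x y z : agree n x y -> agree n y z -> agree n x z.
Proof. by move=> a b i i_n; rewrite a ?b. Qed.

Lemma agreeW n m x y : (m <= n)%N -> agree n x y -> agree m x y.
Proof. by move=> mn a i im; apply: a; exact: leq_trans mn. Qed.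

Lemma near_agree_continuous (Z : topologicalType) (e : Z -> Baire) n (z : Z) :
  continuous e -> \forall y \near z, agree n (e y) (e z).
Proof. by move=> ce; exact: (near_agree n (ce z)). Qed.

(** * Images of countable intersections of clopen sets *)

Section Retraction.
Variables (S : topologicalType) (C : nat -> set S) (h : S -> Baire).
Hypotheses (lC : forall n, locally_constant (C n)) (ch : continuous h).
Variables (p0 : S).
Hypothesis Cp0 : forall n, C n p0.

Let P : set S := [set p | forall n, C n p].

Let candidate (m : nat) (x : S) : set S := [set p | P p /\ agree m (h p) (h x)].
Let good (m : nat) (x : S) := (forall i, (i < m)%N -> C i x) /\ candidate m x !=set0.
Let pick (m : nat) (x : S) : S := xget p0 (candidate m x).

Let last_good : nat -> S -> nat := fix last_good n x :=
  if n is m.+1 then if `[< good n x >] then n else last_good m x else 0%N.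

Let goodW m n x : (m <= n)%N -> good n x -> good m x.
Proof.
move=> mn [Cx [p [Pp a]]]; split; first by move=> i im; apply: Cx; exact: leq_trans mn.
by exists p; split => //; exact: agreeW a.
Qed.

Let last_goodP n x : good (last_good n x) x.
Proof.
elim: n => [|n IH] /=; last by case: asboolP.
by split=> //; exists p0; split.
Qed.

Let last_good_le n x : (last_good n x <= n)%N.
Proof. by elim: n => [|n IH] //=; case: asboolP => // _; exact: leqW. Qed.

Let last_good_max m n x : (m <= n)%N -> good m x -> (m <= last_good n x)%N.
Proof.
elim: n => [|n IH] /=; first by rewrite leqn0 => /eqP->.
rewrite leq_eqVlt => /orP[/eqP->|mn] gm; case: asboolP => // _; first exact: leqW.
exact: IH.
Qed.

Let pickP m x : good m x -> candidate m x (pick m x).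
Proof. by move=> [_ ex]; exact: xgetPex. Qed.

(* Digit [n] is copied from [h x] as long as no test refutes [x] and the prefix
   copied so far extends in [h @` P]; afterwards a fixed extension is followed. *)
Let g (x : S) : Baire := fun n => h (pick (last_good n.+1 x) x) n.

Let g_copy x n : good n.+1 x -> g x n = h x n.
Proof.
move=> gx; rewrite /g.
have -> : last_good n.+1 x = n.+1 by rewrite /=; case: asboolP.
by have [_ a] := pickP gx; apply: a.
Qed.

(** Digit [n] depends only on the first [n.+1] tests and digits of [h x]: [pick] chooses from the
    candidate set, so equal sets give equal choices. *)
Let g_cont : continuous g.
Proof.
apply/continuous_baireP => x n.
have near_C : \forall y \near x, forall i, (i < n.+1)%N -> C i y <-> C i x.
  by apply: (@near_all _ (nbhs x) (fun i y => C i y <-> C i x)) => i; exact: lC.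
apply: filterS2 near_C (near_agree_continuous n.+1 x ch) => y Cy ay.
have cE m : (m <= n.+1)%N -> candidate m y = candidate m x.
  move=> mn; apply/seteqP; split=> p [Pp a]; split=> //; apply: (agree_trans a).
    exact: agreeW mn ay.
  by apply: agreeC; exact: agreeW mn ay.
have gE m : (m <= n.+1)%N -> good m y = good m x.
  move=> mn; rewrite /good cE //; congr (_ /\ _); apply/propext.
  split=> H i im; have := Cy i (leq_trans im mn); move: (H i im); tauto.
have lE m : (m <= n.+1)%N -> last_good m y = last_good m x.
  by elim: m => [|m IH] // mn; rewrite /= gE // IH // ltnW.
by rewrite /g /pick lE // cE // last_good_le.
Qed.

Lemma retract_image : exists f : S -> Baire, continuous f /\ range f = h @` P.
Proof.
exists g; split; first exact: g_cont.
have gP x : P x -> g x = h x.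
  move=> Px; apply/funext => n; apply: g_copy; split=> [i _|]; first exact: Px.
  by exists x.
apply/seteqP; split=> [_ [x _ <-]|_ [x Px <-]]; last by exists x => //; exact: gP.
have [Px|nPx] := pselect (P x); first by exists x => //; rewrite gP.
have [i nCi] : exists i, ~ C i x by exact/existsNP.
have le_i m : good m x -> (m <= i)%N.
  by move=> [Cx _]; rewrite leqNgt; apply/negP => im; apply: nCi; exact: Cx.
(* The failed test [i] bounds every good stage, so [last_good] stays at [m] from stage [m] on, and
   [g x] is [h] of a single pick in [P]. *)
pose m := last_good i x; have gm : good m x by exact: last_goodP.
have [Pq aq] := pickP gm; exists (pick m x) => //.
apply/funext => n; have [mn|nm] := leqP m n.
  rewrite /g (_ : last_good n.+1 x = m) //; apply/eqP; rewrite eqn_leq.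
  rewrite (@last_good_max m n.+1) // ?(leqW mn) // andbT.
  by apply: last_good_max (last_goodP _ _); exact: le_i (last_goodP _ _).
by rewrite g_copy; [exact: aq | exact: goodW gm].
Qed.

End Retraction.

(** The induction on the level replaces [X] by [Baire * X]; a retraction from the Baire space gives
    the points of these spaces digits. *)
Record baire_retract (X : topologicalType) (e : X -> Baire) (r : Baire -> X) :
    Prop := {
  br_section : continuous e;
  br_retraction : continuous r;
  br_cancel : cancel e r }.

Lemma baire_retract_id : baire_retract (id : Baire -> Baire) id.
Proof. by split=> // x; exact: cvg_id. Qed.

Lemma baire_retract_pair (X : topologicalType) (e : X -> Baire) (r : Baire -> X) :
  baire_retract e r ->
  baire_retract (fun z : Baire * X => bpair (z.1, e z.2))
                (fun p => (bfst p, r (bsnd p))).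
Proof.
move=> [ce cr er]; split.
- apply: continuous_comp_fun bpair_continuous; apply: continuous_pair.
    exact: continuous_fst.
  exact: continuous_comp_fun (@continuous_snd _ _) ce.
- apply: continuous_pair; first exact: bfst_continuous.
  exact: continuous_comp_fun bsnd_continuous cr.
- by move=> [p x] /=; rewrite bfstK bsndK /= er.
Qed.

(* [z] is read off [F] along [c], a witness function [w] is read off pointwise; the
   countably many tests [Q n] only inspect [w] at [d n]. *)
Lemma exp_image_of_tests (Y X Z : topologicalType)
    (eY : Y -> nat) (c : nat -> Y)
    (eX : X -> Baire) (rX : Baire -> X) (eZ : Z -> Baire) (rZ : Baire -> Z)
    (proj : Z -> X) (d : nat -> Y) (Q : nat -> nat -> set Z) (A : set X) :
  continuous eY -> cancel c eY -> baire_retract eX rX -> baire_retract eZ rZ ->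
  continuous proj -> (forall n v, locally_constant (Q n v)) -> A !=set0 ->
  (forall x, A x <-> exists z (w : Y -> nat),
    [/\ proj z = x, continuous w & forall n, Q n (w (d n)) z]) ->
  exists f : qcb_exp Y nat -> X, continuous f /\ range f = A.
Proof.
move=> ceY ceYK [ceX crX eXK] [ceZ crZ eZK] cproj lQ [x0 Ax0] AE.
pose zeta (F : qcb_exp Y nat) : Z := rZ (fun n => (nunpair (ev F (c n))).2).
have near_ev (F : qcb_exp Y nat) y : \forall G \near F, ev G y = ev F y.
  by have /continuous_natP := @ev_at_continuous _ y; apply.
have czeta : continuous zeta.
  apply: continuous_comp_fun crZ; apply/continuous_baireP => F i.
  by apply: filterS (near_ev F (c i)) => G ->.
pose C n : set (qcb_exp Y nat) := [set F | Q n (nunpair (ev F (d n))).1 (zeta F)].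
have lC n : locally_constant (C n).
  move=> F; have := czeta F _ (lQ n (nunpair (ev F (d n))).1 (zeta F)).
  by apply: filterS2 (near_ev F (d n)) => G /= e; rewrite /C /= e.
have encode z (w : Y -> nat) : continuous w -> (forall n, Q n (w (d n)) z) ->
    exists F, zeta F = z /\ forall n, C n F.
  (* The function packs [w] with [z]: its second component at [y] is digit [eY y] of [z], so
     evaluating at [c n] recovers digit [n]. *)
  move=> cw Qw; have cF : continuous (fun y => npair (w y) (eZ z (eY y))).
    move/continuous_natP: cw => cw; move/continuous_natP: ceY => ceY.
    by apply/continuous_natP => y; apply: filterS2 (cw y) (ceY y) => y' -> ->.
  have zF : zeta (exp_of cF) = z.
    rewrite /zeta -[RHS]eZK; congr rZ; apply/funext => n.
    by rewrite /ev /= npairK /= ceYK.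
  exists (exp_of cF); split=> // n; rewrite /C /= zF.
  by rewrite /ev /= npairK.
have /AE[z0 [w0 [z0x0 cw0 Qw0]]] := Ax0.
have [F0 [_ CF0]] := encode z0 w0 cw0 Qw0.
have ch : continuous (fun F => eX (proj (zeta F))).
  exact: continuous_comp_fun (continuous_comp_fun czeta cproj) ceX.
have [f [cf rf]] := retract_image lC ch CF0.
exists (rX \o f); split; first exact: continuous_comp_fun cf crX.
rewrite -(image_comp f rX) rf.
apply/seteqP; split=> [_ [_ [F CF <-] <-]|x /AE[z [w [zx cw Qw]]]].
  rewrite eXK; apply/AE; exists (zeta F), (fun y => (nunpair (ev F y)).1).
  split=> //; exact: continuous_comp_fun (@ev_continuous _ F)
    (@continuous_from_nat _ (fun m => (nunpair m).1)).
have [F [zF CF]] := encode z w cw Qw.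
by exists (eX (proj (zeta F))); [exists F | rewrite eXK zF].
Qed.

Lemma locally_constant_prefix (Z : topologicalType) (e : Z -> Baire) n (A : set Z) :
  continuous e -> (forall y z, agree n (e y) (e z) -> A y -> A z) ->
  locally_constant A.
Proof.
move=> ce h z; apply: filterS (near_agree_continuous n z ce) => y a.
by split; apply: h => //; exact: agreeC.
Qed.

Lemma nbhs_prefix (Z : topologicalType) (e : Z -> Baire) (r : Baire -> Z)
    (A : set Z) z : baire_retract e r -> open A -> A z ->
  exists n, forall y, agree n (e y) (e z) -> A y.
Proof.
move=> [ce cr er] oA Az.
have : nbhs (e z) (r @^-1` A).
  by apply: cr; rewrite er; exact: open_nbhs_nbhs.
by move=> /nbhs_agree[n hn]; exists n => y /hn /=; rewrite er.
Qed.

Lemma Sigma1_1_image (X : topologicalType) (eX : X -> Baire) (rX : Baire -> X)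
    (A : set X) : baire_retract eX rX -> A !=set0 -> Sigma1 1 X A ->
  exists f : kleene_kreisel 1 -> X, continuous f /\ range f = A.
Proof.
move=> bX A0 [B /Pi02P[C [V [cC oV BE]]] prB].
have bZ := baire_retract_pair bX; set eZ := (fun z => _) in bZ.
have ceZ := br_section bZ.
(* [w i] is [0] if [z] lies in the closed set [C i], and [j.+1] if the prefix of
   length [j] of [z] guarantees [V i z]. *)
pose Q n v : set (Baire * X) := [set z |
  if v is j.+1 then forall y, agree j (eZ y) (eZ z) -> V (nunpair n).1 y
  else exists2 y, C (nunpair n).1 y & agree (nunpair n).2 (eZ y) (eZ z)].
(* Test [n] codes a pair: the condition [i] at which [w] is read, and a precision [j]. A point lies
   in a closed set when it is approximated there to every precision. *)
apply: (@exp_image_of_tests nat X (Baire * X)%type id id _ _ _ _ snd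
         (fun n => (nunpair n).1) Q A _ _ bX bZ) => //.
- exact: continuous_from_nat.
- exact: continuous_snd.
- move=> n [|j].
    apply: (locally_constant_prefix (n := (nunpair n).2) ceZ) => y z a [y' Cy' a'].
    by exists y' => //; exact: agree_trans a' a.
  apply: (locally_constant_prefix (n := j) ceZ) => y z a h y' a'; apply: h.
  exact: agree_trans a' (agreeC a).
- move=> x; rewrite -prB; split=> [[p /BE Bz]|[[p x'] [w [/= <- _ Qw]]]].
    have /choice[w wP] i : exists v,
      if v is j.+1 then forall y, agree j (eZ y) (eZ (p, x)) -> V i y
      else C i (p, x).
      have [Cz|Vz] := Bz i; first by exists 0%N.
      by have [j hj] := nbhs_prefix bZ (oV i) Vz; exists j.+1.
    exists (p, x), w; split=> //; first exact: continuous_from_nat.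
    move=> n; rewrite /Q /=; have := wP (nunpair n).1.
    by case: (w _) => // Cz; exists (p, x).
  exists p; apply/BE => i; case wi : (w i) => [|j].
    left; apply: contrapT => nC.
    have [j hj] := nbhs_prefix bZ (closed_openC (cC i)) nC.
    have := Qw (npair i j); rewrite /Q npairK /= wi => -[y Cy a].
    exact: hj a Cy.
  right; have := Qw (npair i 0); rewrite /Q npairK /= wi; apply.
  by [].
Qed.

Lemma exp_image_of_compl (Y X : topologicalType) (eY : Y -> nat) (c : nat -> Y)
    (eX : X -> Baire) (rX : Baire -> X) (f : Y -> Baire * X) (A : set X) :
  separable_space Y -> continuous eY -> cancel c eY -> baire_retract eX rX ->
  continuous f -> A !=set0 -> A = pr (~` range f) ->
  exists f : qcb_exp Y nat -> X, continuous f /\ range f = A.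
Proof.
move=> [d dd] ceY ceYK bX cf A0 AE.
have bZ := baire_retract_pair bX; set eZ := (fun z => _) in bZ.
have ceZ := br_section bZ.
pose g y := eZ (f y); have cg : continuous g by exact: continuous_comp_fun cf ceZ.
pose differ_at y v z := agree v (g y) (eZ z) /\ g y v <> eZ z v.
apply: (@exp_image_of_tests Y X (Baire * X)%type eY c _ _ _ _ snd d
         (fun n v => [set z | differ_at (d n) v z]) A _ _ bX bZ) => //.
- exact: continuous_snd.
- move=> n v; apply: (locally_constant_prefix (n := v.+1) ceZ) => y z a [a' ne].
  split; first by apply: agree_trans a' _; exact: agreeW a.
  by rewrite -(a v).
- move=> x; rewrite AE; split=> [[p nf]|[[p x'] [w [/= <- cw Qw]]]].
    have ex y : exists v, g y v != eZ (p, x) v.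
      apply: contrapT => h; apply: nf; exists y => //.
      apply: (can_inj (br_cancel bZ)); apply/funext => v.
      by apply/eqP/negPn/negP => ne; apply: h; exists v.
    pose w y := ex_minn (ex y).
    have wP y : differ_at y (w y) (p, x).
      rewrite /w; case: ex_minnP => v /eqP ne vmin; split=> // i iv.
      by apply/eqP; apply: contraTT iv => /vmin; rewrite -leqNgt.
    exists (p, x), w; split=> [//||n]; last exact: wP.
    (* The least differing digit is decided by a finite prefix of [g y], hence locally constant in
       [y]. *)
    apply/continuous_natP => y.
    apply: filterS (near_agree_continuous (w y).+1 y cg) => y' a.
    have [a1 n1] := wP y; have [a2 n2] := wP y'.
    case: (ltngtP (w y') (w y)) => // lt; exfalso.
      by apply: n2; rewrite a ?a1 // ltnW.
    by apply: n1; rewrite -a // a2.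
  exists p => -[y _ fy]; suff [_] : differ_at y (w y) (p, x').
    by rewrite /g fy.
  (* If [w] is wrong at [y], it is wrong on an open set, hence at some [d n], where it was
     tested. *)
  apply: contrapT => nd.
  have [n] : exists n, [set y | ~ differ_at y (w y) (p, x')] (d n).
    apply: dd; last by exists y.
    move/continuous_natP: cw => cw; rewrite openE => t nt.
    apply: filterS2 (cw t) (near_agree_continuous (w t).+1 t cg).
    move=> t' /= -> a [a1 n1]; apply: nt.
    split; first by apply: agree_trans a1; apply: agreeC; exact: agreeW a.
    by rewrite -(a (w t)).
  by apply; exact: Qw.
Qed.

Definition kleene_kreisel_point k : kleene_kreisel k :=
  match k with 0 => 0%N | k'.+1 => const_exp (kleene_kreisel k') 0 end.

Lemma Sigma1_image k (X : topologicalType) (eX : X -> Baire) (rX : Baire -> X)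
    (A : set X) : baire_retract eX rX -> A !=set0 -> Sigma1 k.+1 X A ->
  exists f : kleene_kreisel k.+1 -> X, continuous f /\ range f = A.
Proof.
elim: k => [|k IH] in X eX rX A *; first exact: Sigma1_1_image.
move=> bX A0 [_ [B SB <-] prB].
have [R [nR _ _]] := kleene_kreisel_names k.
have sY := name_separable nR (kleene_kreisel_point k.+1).
(* Evaluation at a fixed point, with constant functions as section, makes [nat] a retract of the
   space. *)
pose eY (F : kleene_kreisel k.+1) := ev F (kleene_kreisel_point k).
have ceY : continuous eY by exact: ev_at_continuous.
have ceYK : cancel (const_exp (kleene_kreisel k)) eY by [].
have [B0|nB0] := pselect (B !=set0).
  have [f [cf rf]] := IH _ _ _ _ (baire_retract_pair bX) B0 SB.
  by apply: (exp_image_of_compl sY ceY ceYK bX cf A0); rewrite rf.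
(* An empty [B] is not a range, but then [A] is all of [X] and trivial tests suffice. *)
apply: (@exp_image_of_tests _ X X eY _ _ _ _ _ id
  (fun=> kleene_kreisel_point k.+1) (fun _ _ => setT) A ceY ceYK bX bX) => //.
- by move=> x; exact: cvg_id.
- by move=> _ _ x; exact: nearW.
- move=> x; split=> [_|_].
    by exists x, eY.
  by rewrite -prB; exists (fun=> 0%N) => Bz; apply: nB0; eexists; exact: Bz.
Qed.

Theorem theorem7p6 (k : nat) (B : set Baire) (hk : (0 < k)%N) (hB : B !=set0) :
  Sigma1 k Baire B <->
  exists f : kleene_kreisel k -> Baire, continuous f /\ range f = B.
Proof.
case: k hk => // k _; split; first exact: Sigma1_image baire_retract_id hB.
move=> [f [cf <-]]; have [R [nR SR _]] := kleene_kreisel_names k.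
exact: Sigma1_range nR SR cf.
Qed.
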